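(* Let $V\xrightarrow{R}\mathfrak{g}$ be an rRB Leibniz algebra and let $(W\xrightarrow{S}\mathfrak{h},l,r)$ be a representation of it. Then: (i) The direct sum $\mathfrak{g}\oplus\mathfrak{h}$ carries a Leibniz algebra structure (denoted $\mathfrak{g}\ltimes\mathfrak{h}$) with the bracket $$[(x,h),(y,k)]_{\mathfrak{g}\oplus\mathfrak{h}}:=\big([x,y]_\mathfrak{g},\ l_\mathfrak{h}(x,k)+r_\mathfrak{h}(h,y)\big),\quad (x,h),(y,k)\in\mathfrak{g}\oplus\mathfrak{h}.$$ (ii) The vector space $V\oplus W$ is a representation of the Leibniz algebra $\mathfrak{g}\ltimes\mathfrak{h}$ with left and right actions $$l_\ltimes((x,h),(v,w)):=(l_V(x,v),\ l_W(x,w)+r(h,v)),\qquad r_\ltimes((v,w),(x,h)):=(r_V(v,x),\ l(v,h)+r_W(w,x)).$$ (iii) With $\mathfrak{g}\oplus\mathfrak{h}$ equipped with the Leibniz bracket $[~,~]_{\mathfrak{g}\oplus\mathfrak{h}}$ and $V\oplus W$ equipped with the actions $l_\ltimes,r_\ltimes$ of $\mathfrak{g}\ltimes\mathfrak{h}$, the map $R\oplus S:V\oplus W\to\mathfrak{g}\oplus\mathfrak{h}$ is a relative Rota-Baxter operator; in other words, $V\oplus W\xrightarrow{R\oplus S}\mathfrak{g}\oplus\mathfrak{h}$ is an rRB Leibniz algebra (called the semidirect product). (iv) Let $i_\mathfrak{g}:\mathfrak{g}\hookrightarrow\mathfrak{g}\oplus\mathfrak{h}$ and $i_V:V\hookrightarrow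 V\oplus W$ be the inclusion maps. Then the pair $(i_\mathfrak{g},i_V)$ is a morphism of rRB Leibniz algebras from $V\xrightarrow{R}\mathfrak{g}$ to the semidirect product $V\oplus W\xrightarrow{R\oplus S}\mathfrak{g}\oplus\mathfrak{h}$.
   Context: All vector spaces and linear maps are over a field $\mathbf{k}$ of characteristic $0$. Leibniz algebra: a vector space $\mathfrak{g}$ with a linear map $[~,~]_\mathfrak{g}:\mathfrak{g}\otimes\mathfrak{g}\to\mathfrak{g}$ satisfying $[x,[y,z]_\mathfrak{g}]_\mathfrak{g}=[[x,y]_\mathfrak{g},z]_\mathfrak{g}+[y,[x,z]_\mathfrak{g}]_\mathfrak{g}$. A representation of $\mathfrak{g}$ is a vector space $V$ with linear maps $l_V:\mathfrak{g}\otimes V\to V$, $r_V:V\otimes\mathfrak{g}\to V$ such that $l_V(x,l_V(y,v))=l_V([x,y]_\mathfrak{g},v)+l_V(y,l_V(x,v))$; $l_V(x,r_V(v,y))=r_V(l_V(x,v),y)+r_V(v,[x,y]_\mathfrak{g})$; $r_V(v,[x,y]_\mathfrak{g})=r_V(r_V(v,x),y)+l_V(x,r_V(v,y))$. An rRB Leibniz algebra $V\xrightarrow{R}\mathfrak{g}$ consists of a Leibniz algebra $\mathfrak{g}$, a representation $(V,l_V,r_V)$ of it, and a relative Rota-Baxter operator, i.e. a linear map $R:V\to\mathfrak{g}$ with $[R(v),R(v')]_\mathfrak{g}=R(l_V(R(v),v')+r_V(v,R(v')))$ for $v,v'\in V$. A morphism from $V\xrightarrow{R}\mathfrak{g}$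 to $V'\xrightarrow{R'}\mathfrak{g}'$ is a pair $(\phi,\psi)$ of a Leibniz algebra morphism $\phi:\mathfrak{g}\to\mathfrak{g}'$ and a linear map $\psi:V\to V'$ with $\psi(l_V(x,v))=l_{V'}(\phi(x),\psi(v))$, $\psi(r_V(v,x))=r_{V'}(\psi(v),\phi(x))$ and $\phi\circ R=R'\circ\psi$. A representation of $V\xrightarrow{R}\mathfrak{g}$ is a triple $(W\xrightarrow{S}\mathfrak{h},l,r)$ where $W$ and $\mathfrak{h}$ are representations of the Leibniz algebra $\mathfrak{g}$ (actions $l_W,r_W$ and $l_\mathfrak{h},r_\mathfrak{h}$), $S:W\to\mathfrak{h}$ is a linear map (a 2-term chain complex), and $l:V\otimes\mathfrak{h}\to W$, $r:\mathfrak{h}\otimes V\to W$ are linear maps such that for all $x\in\mathfrak{g}$, $v\in V$, $h\in\mathfrak{h}$, $w\in W$: $l_W(x,l(v,h))=l(l_V(x,v),h)+l(v,l_\mathfrak{h}(x,h))$; $l(v,l_\mathfrak{h}(x,h))=l(r_V(v,x),h)+l_W(x,l(v,h))$; $l(v,r_\mathfrak{h}(h,x))=r_W(l(v,h),x)+r(h,r_V(v,x))$; $l_W(x,r(h,v))=r(l_\mathfrak{h}(x,h),v)+r(h,l_V(x,v))$; $r(h,l_V(x,v))=r(r_\mathfrak{h}(h,x),v)+l_W(x,r(h,v))$; $r(h,r_V(v,x))=r_W(r(h,v),x)+l(v,r_\mathfrak{h}(h,x))$; $l_\mathfrak{h}(R(v),S(w))=S(l_W(R(v),w)+l(v,S(w)))$;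 $r_\mathfrak{h}(S(w),R(v))=S(r(S(w),v)+r_W(w,R(v)))$. *)

(* Defs.v *)
From mathcomp Require Import all_boot all_order all_algebra.

Set Implicit Arguments.
Unset Strict Implicit.
Unset Printing Implicit Defensive.

Import GRing.Theory.
Local Open Scope ring_scope.

(* A linear map A (x) B -> C is given by the corresponding curried bilinear
   map A -> B -> C, with the arguments in the order of the tensor factors:
   left actions are g -> V -> V and right actions are V -> g -> V. *)
Definition is_bilinear (k : fieldType) (A B C : lmodType k) (f : A -> B -> C) :
    Prop :=
  (forall b : B, linear (fun a : A => f a b)) /\ (forall a : A, linear (f a)).

Record is_leibniz (k : fieldType) (g : lmodType k) (br : g -> g -> g) : Prop :=
  IsLeibniz {
    leibniz_bilinear : is_bilinear br;
    leibniz_identity : forall x y z : g,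
      br x (br y z) = br (br x y) z + br y (br x z)
  }.

Record is_leibniz_rep (k : fieldType) (g V : lmodType k) (br : g -> g -> g)
    (lV : g -> V -> V) (rV : V -> g -> V) : Prop :=
  IsLeibnizRep {
    rep_l_bilinear : is_bilinear lV;
    rep_r_bilinear : is_bilinear rV;
    rep_LLM : forall (x y : g) (v : V),
      lV x (lV y v) = lV (br x y) v + lV y (lV x v);
    rep_LML : forall (x y : g) (v : V),
      lV x (rV v y) = rV (lV x v) y + rV v (br x y);
    rep_MLL : forall (x y : g) (v : V),
      rV v (br x y) = rV (rV v x) y + lV x (rV v y)
  }.

Record is_relative_RB (k : fieldType) (g V : lmodType k) (br : g -> g -> g)
    (lV : g -> V -> V) (rV : V -> g -> V) (R : V -> g) : Prop :=
  IsRelativeRB {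
    RB_linear : linear R;
    RB_identity : forall v v' : V,
      br (R v) (R v') = R (lV (R v) v' + rV v (R v'))
  }.

Record is_rRB_leibniz (k : fieldType) (g V : lmodType k) (br : g -> g -> g)
    (lV : g -> V -> V) (rV : V -> g -> V) (R : V -> g) : Prop :=
  IsRRBLeibniz {
    rRB_leibniz : is_leibniz br;
    rRB_leibniz_rep : is_leibniz_rep br lV rV;
    rRB_operator : is_relative_RB br lV rV R
  }.

Record is_leibniz_morphism (k : fieldType) (g g' : lmodType k)
    (br : g -> g -> g) (br' : g' -> g' -> g') (phi : g -> g') : Prop :=
  IsLeibnizMorphism {
    leibniz_mor_linear : linear phi;
    leibniz_mor_bracket : forall x y : g, phi (br x y) = br' (phi x) (phi y)
  }.

(* Morphism conditions only: that the source and the target are rRB Leibniz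
   algebras is stated separately. *)
Record is_rRB_morphism (k : fieldType) (g V g' V' : lmodType k)
    (br : g -> g -> g) (lV : g -> V -> V) (rV : V -> g -> V) (R : V -> g)
    (br' : g' -> g' -> g') (lV' : g' -> V' -> V') (rV' : V' -> g' -> V')
    (R' : V' -> g') (phi : g -> g') (psi : V -> V') : Prop :=
  IsRRBMorphism {
    rRB_mor_leibniz : is_leibniz_morphism br br' phi;
    rRB_mor_linear : linear psi;
    rRB_mor_l : forall (x : g) (v : V), psi (lV x v) = lV' (phi x) (psi v);
    rRB_mor_r : forall (v : V) (x : g), psi (rV v x) = rV' (psi v) (phi x);
    rRB_mor_op : forall v : V, phi (R v) = R' (psi v)
  }.

Record is_rRB_rep (k : fieldType) (g V h W : lmodType k)
    (br : g -> g -> g) (lV : g -> V -> V) (rV : V -> g -> V) (R : V -> g)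
    (lh : g -> h -> h) (rh : h -> g -> h) (lW : g -> W -> W) (rW : W -> g -> W)
    (S : W -> h) (l : V -> h -> W) (r : h -> V -> W) : Prop :=
  IsRRBRep {
    rRB_rep_W : is_leibniz_rep br lW rW;
    rRB_rep_h : is_leibniz_rep br lh rh;
    rRB_rep_S_linear : linear S;
    rRB_rep_l_bilinear : is_bilinear l;
    rRB_rep_r_bilinear : is_bilinear r;
    rRB_rep_lW_l : forall (x : g) (v : V) (u : h),
      lW x (l v u) = l (lV x v) u + l v (lh x u);
    rRB_rep_l_lh : forall (x : g) (v : V) (u : h),
      l v (lh x u) = l (rV v x) u + lW x (l v u);
    rRB_rep_l_rh : forall (x : g) (v : V) (u : h),
      l v (rh u x) = rW (l v u) x + r u (rV v x);
    rRB_rep_lW_r : forall (x : g) (v : V) (u : h),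
      lW x (r u v) = r (lh x u) v + r u (lV x v);
    rRB_rep_r_lV : forall (x : g) (v : V) (u : h),
      r u (lV x v) = r (rh u x) v + lW x (r u v);
    rRB_rep_r_rV : forall (x : g) (v : V) (u : h),
      r u (rV v x) = rW (r u v) x + l v (rh u x);
    rRB_rep_lh_S : forall (v : V) (w : W),
      lh (R v) (S w) = S (lW (R v) w + l v (S w));
    rRB_rep_rh_S : forall (v : V) (w : W),
      rh (S w) (R v) = S (r (S w) v + rW w (R v))
  }.

Section SemidirectProduct.
Variables (k : fieldType) (g V h W : lmodType k).

Definition semidirect_bracket (br : g -> g -> g) (lh : g -> h -> h)
    (rh : h -> g -> h) (a b : g * h) : g * h :=
  (br a.1 b.1, lh a.1 b.2 + rh a.2 b.1).

Definition semidirect_l (lV : g -> V -> V) (lW : g -> W -> W) (r : h -> V -> W)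
    (a : g * h) (p : V * W) : V * W :=
  (lV a.1 p.1, lW a.1 p.2 + r a.2 p.1).

Definition semidirect_r (rV : V -> g -> V) (rW : W -> g -> W) (l : V -> h -> W)
    (p : V * W) (a : g * h) : V * W :=
  (rV p.1 a.1, l p.1 a.2 + rW p.2 a.1).

Definition dsum_map (R : V -> g) (S : W -> h) (p : V * W) : g * h :=
  (R p.1, S p.2).

End SemidirectProduct.

Definition dsum_inl (k : fieldType) (A B : lmodType k) (a : A) : A * B := (a, 0).

(* Main.v *)
Require Import Defs.
From mathcomp Require Import all_boot all_order all_algebra.

Set Implicit Arguments.
Unset Strict Implicit.
Unset Printing Implicit Defensive.

Import GRing.Theory.
Local Open Scope ring_scope.

(** Every structure map of the semidirect product sends a pair of elements of [h] or [W] to zero,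
    and every identity to check is additive in each argument. So an identity splits into the case
    with all entries from [g] and [V], which is the one already known there, and the cases with
    exactly one entry from [h] or [W], which are the axioms of the representation. The second
    component is the sum of these latter cases: three for each Leibniz-type identity, regrouped by
    [addr_semidirect], and two for the Rota-Baxter identity. *)

Section LinearMaps.
Variables (k : fieldType) (A B : lmodType k).

Lemma linear_mapD (f : A -> B) :
  linear f -> forall a a', f (a + a') = f a + f a'.
Proof. by move=> fl a a'; have := fl 1 a a'; rewrite !scale1r. Qed.

Lemma linear_map0 (f : A -> B) : linear f -> f 0 = 0.
Proof. by move=> fl; apply: (addrI (f 0)); rewrite -linear_mapD // !addr0. Qed.

Lemma dsum_inl_linear : linear (@dsum_inl k A B).
Proof. by move=> c a a'; congr pair; rewrite /= scaler0 addr0. Qed.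

End LinearMaps.

Section BilinearMaps.
Variables (k : fieldType) (A B C : lmodType k) (f : A -> B -> C).
Hypothesis fB : is_bilinear f.

Lemma bilinearDl a a' b : f (a + a') b = f a b + f a' b.
Proof. exact: (linear_mapD (fB.1 b)). Qed.

Lemma bilinearDr a b b' : f a (b + b') = f a b + f a b'.
Proof. exact: (linear_mapD (fB.2 a)). Qed.

Lemma bilinear0l b : f 0 b = 0.
Proof. exact: (linear_map0 (fB.1 b)). Qed.

Lemma bilinear0r a : f a 0 = 0.
Proof. exact: (linear_map0 (fB.2 a)). Qed.

End BilinearMaps.

(* The bracket and both actions of the semidirect product have this shape. *)
Lemma semidirect_bilinear (k : fieldType) (A1 A2 B1 B2 C1 C2 : lmodType k)
    (f : A1 -> B1 -> C1) (p : A1 -> B2 -> C2) (q : A2 -> B1 -> C2) :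
  is_bilinear f -> is_bilinear p -> is_bilinear q ->
  is_bilinear (fun (a : A1 * A2) (b : B1 * B2) =>
    (f a.1 b.1, p a.1 b.2 + q a.2 b.1)).
Proof.
case=> fl fr [pl pr] [ql qr]; split=> [[b1 b2] c [a1 a2] [a1' a2']
                                      |[a1 a2] c [b1 b2] [b1' b2']];
  congr pair => /=.
- exact: fl.
- by rewrite pl ql scalerDr addrACA.
- exact: fr.
- by rewrite pr qr scalerDr addrACA.
Qed.

(* On second components each Leibniz-type identity of the semidirect product is
   the sum of three identities [a + a'], [b + b'], [c + c'], up to this
   rearrangement. *)
Lemma addr_semidirect (M : zmodType) (a a' b b' c c' : M) :
  (a + a') + (b + b') + (c + c') = (a + (b + c)) + ((a' + c') + b').
Proof. by rewrite (AC (2*2*2) ((1*(3*5))*((2*6)*4))). Qed.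

Theorem theorem4p10
  (k : fieldType) (k_char0 : [pchar k] =i pred0)
  (g V h W : lmodType k)
  (br : g -> g -> g) (lV : g -> V -> V) (rV : V -> g -> V) (R : V -> g)
  (rRB_VRg : is_rRB_leibniz br lV rV R)
  (lh : g -> h -> h) (rh : h -> g -> h) (lW : g -> W -> W) (rW : W -> g -> W)
  (S : W -> h) (l : V -> h -> W) (r : h -> V -> W)
  (rep_WSh : is_rRB_rep br lV rV R lh rh lW rW S l r) :
  [/\ is_leibniz (semidirect_bracket br lh rh),
      is_leibniz_rep (semidirect_bracket br lh rh)
        (semidirect_l lV lW r) (semidirect_r rV rW l),
      is_relative_RB (semidirect_bracket br lh rh)
        (semidirect_l lV lW r) (semidirect_r rV rW l) (dsum_map R S) /\
      is_rRB_leibniz (semidirect_bracket br lh rh)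
        (semidirect_l lV lW r) (semidirect_r rV rW l) (dsum_map R S)
    & is_rRB_morphism br lV rV R
        (semidirect_bracket br lh rh)
        (semidirect_l lV lW r) (semidirect_r rV rW l) (dsum_map R S)
        (@dsum_inl k g h) (@dsum_inl k V W)].
Proof.
case: rRB_VRg => -[brB brL] [lVB rVB VLLM VLML VMLL] [RL RE].
case: rep_WSh => -[lWB rWB WLLM WLML WMLL] [lhB rhB hLLM hLML hMLL] SL lB rB.
move=> lW_l l_lh l_rh lW_r r_lV r_rV lh_S rh_S.
have leib : is_leibniz (semidirect_bracket br lh rh).
  split=> [|[x a] [y b] [z c]]; first exact: semidirect_bilinear.
  congr pair => /=; first exact: brL.
  (* The entry from [h] is [c], [a] and [b] respectively. [hMLL] expands [rh a (br y z)] before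
     [hLML] creates [rh b (br x z)], which must stay. *)
  rewrite (bilinearDr lhB) hLLM hMLL hLML addr_semidirect.
  by rewrite -(bilinearDl rhB) -(bilinearDr lhB).
have rep : is_leibniz_rep (semidirect_bracket br lh rh)
    (semidirect_l lV lW r) (semidirect_r rV rW l).
  split=> [||[x a] [y b] [v w]|[x a] [y b] [v w]|[x a] [y b] [v w]].
  - exact: semidirect_bilinear.
  - exact: semidirect_bilinear.
  - congr pair => /=; first exact: VLLM.
    (* Here and in the next two cases, the [W] axiom handles [w]; the two axioms on [l] and [r]
       handle [a] and [b]. *)
    rewrite (bilinearDr lWB) WLLM r_lV lW_r addr_semidirect.
    by rewrite -(bilinearDl rB) -(bilinearDr lWB).
  - congr pair => /=; first exact: VLML.
    rewrite (bilinearDr lWB) lW_l WLML r_rV addr_semidirect.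
    by rewrite -(bilinearDl rWB) -(bilinearDr lB).
  - congr pair => /=; first exact: VMLL.
    rewrite (bilinearDr lB) l_lh l_rh WMLL addr_semidirect.
    by rewrite -(bilinearDl rWB) -(bilinearDr lWB).
have RB : is_relative_RB (semidirect_bracket br lh rh)
    (semidirect_l lV lW r) (semidirect_r rV rW l) (dsum_map R S).
  split=> [c [v w] [v' w']|[v w] [v' w']]; congr pair => /=.
  - exact: RL.
  - exact: SL.
  - exact: RE.
  (* [lh_S] is the case [w = 0] and [rh_S] the case [w' = 0]. *)
  - by rewrite lh_S rh_S -(linear_mapD SL) addrACA.
(* Only the morphism remains: the inclusions have zero second component, so all terms involving [h]
   or [W] vanish. *)
split=> //; split.
- split=> [|x y]; first exact: dsum_inl_linear.
  by congr pair => /=; rewrite (bilinear0r lhB) (bilinear0l rhB) addr0.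
- exact: dsum_inl_linear.
- move=> x v; congr pair => /=.
  by rewrite (bilinear0r lWB) (bilinear0l rB) addr0.
- move=> v x; congr pair => /=.
  by rewrite (bilinear0r lB) (bilinear0l rWB) addr0.
- by move=> v; congr pair => /=; rewrite (linear_map0 SL).
Qed.
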